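(* Let $p$ be an odd positive integer and $G$ a graph. Set $q=\mathrm{wcol}_p(G)$. (a) We have $\chi\bigl(G^{[\natural 1]}\cup G^{[\natural 3]}\cup\cdots\cup G^{[\natural p]}\bigr)\le\bigl(\bigl\lfloor\frac12p\bigr\rfloor+2\bigr)^q$. (b) If $G$ has odd girth at least $p+1$, then $\chi\bigl(G^{\natural 1}\cup G^{\natural 3}\cup\cdots\cup G^{\natural p}\bigr)\le\bigl(\bigl\lfloor\frac12p\bigr\rfloor+2\bigr)^q$. Here the unions are over all odd integers from $1$ to $p$.
   Context: All graphs are finite, undirected, simple and without loops. $\chi$ denotes the chromatic number. The length of a path is its number of edges. For two graphs $G=(V,E)$ and $G'=(V,E')$ on the same vertex set, $G\cup G'=(V,E\cup E')$. For a graph $G=(V,E)$ and a positive integer $p$: the exact distance-$p$ graph $G^{[\natural p]}$ has vertex set $V$, and $xy$ is an edge if and only if the distance between $x$ and $y$ in $G$ is exactly $p$; the exact $p$-power graph $G^{\natural p}$ has vertex set $V$, and $xy$ (with $x\neq y$) is an edge if and only if there is in $G$ a path (no repeated vertices, not necessarily a shortest path) of length exactly $p$ between $x$ and $y$. The odd girth of $G$ is the length of a shortest odd cycle (infinite if there is none). Weak colouring numbers: let $L$ be a linear ordering of $V$ and $k$ a positive integer. A vertex $x$ is weakly $k$-accessible from $y$ if $x<_L y$ and there is an $xy$-path of length at most $k$ all of whose internal vertices $z$ satisfy $x<_L z$. Let $Q_{L,k}(y)$ be the set of vertices weakly $k$-accessible from $y$, and $\mathrm{wcol}_k(G)=1+\min_L\max_{y\in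 V}|Q_{L,k}(y)|$, the minimum being over all linear orderings $L$ of $V$. *)

(* Defs.v *)
From mathcomp Require Import all_boot.
Set Implicit Arguments.
Unset Strict Implicit.
Unset Printing Implicit Defensive.

Record sgraph (T : finType) := SGraph {
  adj :> rel T;
  adj_sym : symmetric adj;
  adj_irr : irreflexive adj }.

Lemma empty_graph_sym (T : finType) : symmetric (fun _ _ : T => false).
Proof. by []. Qed.
Lemma empty_graph_irr (T : finType) : irreflexive (fun _ _ : T => false).
Proof. by []. Qed.
Definition empty_graph (T : finType) : sgraph T :=
  SGraph (@empty_graph_sym T) (@empty_graph_irr T).

Lemma graph_union_sym (T : finType) (G H : sgraph T) :
  symmetric (fun x y => G x y || H x y).
Proof. by move=> x y; rewrite adj_sym (adj_sym H). Qed.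
Lemma graph_union_irr (T : finType) (G H : sgraph T) :
  irreflexive (fun x y => G x y || H x y).
Proof. by move=> x; rewrite !adj_irr. Qed.
Definition graph_union (T : finType) (G H : sgraph T) : sgraph T :=
  SGraph (graph_union_sym G H) (graph_union_irr G H).

Definition colorable (T : finType) (G : sgraph T) (n : nat) : bool :=
  [exists c : {ffun T -> 'I_n}, [forall x, forall y, G x y ==> (c x != c y)]].

Lemma colorable_ex (T : finType) (G : sgraph T) : exists n, colorable G n.
Proof.
exists #|T|; apply/existsP; exists [ffun x => enum_rank x].
apply/forallP=> x; apply/forallP=> y; apply/implyP=> Gxy.
rewrite !ffunE (inj_eq enum_rank_inj); apply: contraTneq Gxy => ->.
by rewrite adj_irr.
Qed.

Definition chi (T : finType) (G : sgraph T) : nat := ex_minn (colorable_ex G).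

(* x :: t is the vertex sequence of a path from x to y; its length is size t. *)
Definition is_path (T : finType) (G : sgraph T) (x y : T) (t : seq T) : bool :=
  [&& path G x t, uniq (x :: t) & last x t == y].

Definition has_path (T : finType) (G : sgraph T) (k : nat) (x y : T) : bool :=
  [exists t : k.-tuple T, is_path G x y t].

Definition has_cycle (T : finType) (G : sgraph T) (k : nat) : bool :=
  (2 < k) && [exists c : k.-tuple T, cycle G c && uniq c].

Lemma is_path_sym (T : finType) (G : sgraph T) (x y : T) (t : seq T) :
  is_path G x y t -> is_path G y x (rev (belast x t)).
Proof.
case/and3P=> Gt Ut /eqP <-.
have E : last x t :: rev (belast x t) = rev (x :: t).
  by rewrite [x :: t]lastI rev_rcons.
apply/and3P; split.
- by rewrite rev_path (eq_path (e' := G)) // => a b; rewrite adj_sym.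
- by rewrite E rev_uniq.
- by case: t {Gt Ut E} => //= a t; rewrite rev_cons last_rcons.
Qed.

Lemma has_path_sym (T : finType) (G : sgraph T) (k : nat) :
  symmetric (has_path G k).
Proof.
have H x y : has_path G k x y -> has_path G k y x.
  case/existsP=> t /is_path_sym Pt; apply/existsP.
  have St : size (rev (belast x t)) == k by rewrite size_rev size_belast size_tuple.
  by exists (Tuple St).
by move=> x y; apply/idP/idP; apply: H.
Qed.

(* The least k < n with P k, if any; None plays the role of infinity below. *)
Definition least (n : nat) (P : pred nat) : option nat :=
  ohead [seq k <- iota 0 n | P k].

(* A path has fewer than #|T| edges and a cycle at most #|T|, so the bounds
   given to [least] are harmless (see dist_SomeP and odd_girth_SomeP). *)
Definition dist (T : finType) (G : sgraph T) (x y : T) : option nat :=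
  least #|T| (fun k => has_path G k x y).

Definition odd_girth (T : finType) (G : sgraph T) : option nat :=
  least #|T|.+1 (fun k => odd k && has_cycle G k).

Definition at_least (o : option nat) (n : nat) : bool :=
  if o is Some g then n <= g else true.

Lemma least_SomeP (n : nat) (P : pred nat) (k : nat) :
  (forall i, P i -> i < n) ->
  (least n P = Some k) <-> (P k /\ forall i, P i -> k <= i).
Proof.
move=> Pn; rewrite /least.
have srt : sorted ltn [seq k <- iota 0 n | P k].
  by apply: sorted_filter (iota_ltn_sorted _ _); apply: ltn_trans.
have mem i : (i \in [seq k <- iota 0 n | P k]) = P i.
  rewrite mem_filter mem_iota /= add0n; case Pi: (P i) => //=; exact: Pn.
case: [seq k <- iota 0 n | P k] srt mem => [|a s] /= srt mem.
  by split=> // -[Pk _]; move: (mem k); rewrite Pk.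
have min i : P i -> a <= i.
  rewrite -mem inE => /predU1P[->//|/(allP (order_path_min ltn_trans srt))].
  exact: ltnW.
have Pa : P a by rewrite -mem mem_head.
split=> [[<-]//|[Pk kmin]]; congr Some; apply/eqP.
by rewrite eqn_leq min // kmin.
Qed.

Lemma has_path_lt (T : finType) (G : sgraph T) (x y : T) (k : nat) :
  has_path G k x y -> k < #|T|.
Proof.
case/existsP=> t /and3P[_ /card_uniqP /= U _].
by rewrite -[k in k < _](size_tuple t) -U max_card.
Qed.

Lemma dist_SomeP (T : finType) (G : sgraph T) (x y : T) (k : nat) :
  dist G x y = Some k <->
  (has_path G k x y /\ forall i, has_path G i x y -> k <= i).
Proof. by apply: least_SomeP => i; apply: has_path_lt. Qed.

Lemma odd_girth_SomeP (T : finType) (G : sgraph T) (k : nat) :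
  odd_girth G = Some k <->
  (odd k && has_cycle G k /\ forall i, odd i && has_cycle G i -> k <= i).
Proof.
apply: least_SomeP => i /and3P[_ _ /existsP[c /andP[_ /card_uniqP U]]].
by rewrite ltnS -(size_tuple c) -U max_card.
Qed.

Lemma dist_sym (T : finType) (G : sgraph T) (x y : T) : dist G x y = dist G y x.
Proof.
by rewrite /dist /least (eq_filter (a2 := fun k => has_path G k y x)) // => k;
  rewrite has_path_sym.
Qed.

(* In the next two graphs the condition x != y only matters for p = 0. *)
Lemma exact_dist_sym (T : finType) (G : sgraph T) (p : nat) :
  symmetric (fun x y => (x != y) && (dist G x y == Some p)).
Proof. by move=> x y; rewrite eq_sym dist_sym. Qed.
Lemma exact_dist_irr (T : finType) (G : sgraph T) (p : nat) :
  irreflexive (fun x y => (x != y) && (dist G x y == Some p)).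
Proof. by move=> x; rewrite eqxx. Qed.
Definition exact_dist_graph (T : finType) (G : sgraph T) (p : nat) : sgraph T :=
  SGraph (exact_dist_sym G p) (exact_dist_irr G p).

Lemma exact_power_sym (T : finType) (G : sgraph T) (p : nat) :
  symmetric (fun x y => (x != y) && has_path G p x y).
Proof. by move=> x y; rewrite eq_sym has_path_sym. Qed.
Lemma exact_power_irr (T : finType) (G : sgraph T) (p : nat) :
  irreflexive (fun x y => (x != y) && has_path G p x y).
Proof. by move=> x; rewrite eqxx. Qed.
Definition exact_power_graph (T : finType) (G : sgraph T) (p : nat) : sgraph T :=
  SGraph (exact_power_sym G p) (exact_power_irr G p).

Definition odd_union (T : finType) (F : nat -> sgraph T) (p : nat) : sgraph T :=
  \big[@graph_union T/empty_graph T]_(1 <= i < p.+1 | odd i) F i.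

Lemma odd_unionP (T : finType) (F : nat -> sgraph T) (p : nat) (x y : T) :
  reflect (exists i, [/\ odd i, i <= p & F i x y]) (odd_union F p x y).
Proof.
have -> : odd_union F p x y = has (fun i => odd i && F i x y) (index_iota 1 p.+1).
  rewrite /odd_union; elim: (index_iota 1 p.+1) => [|i s IHs]; first by rewrite big_nil.
  by rewrite big_cons /= -IHs; case: (odd i).
apply: (iffP hasP) => [[i]|[i [oi ip Fi]]].
  by rewrite mem_index_iota ltnS => /andP[_ ip] /andP[oi Fi]; exists i.
by exists i; rewrite ?oi // mem_index_iota ltnS ip odd_gt0.
Qed.

(* A linear ordering is given by its set of pairs (x, y) with x <_L y. *)
Definition before (T : finType) (L : {set T * T}) : rel T :=
  fun x y => (x, y) \in L.

Definition linear_ordering (T : finType) (L : {set T * T}) : bool :=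
  [&& [forall x, ~~ before L x x],
      [forall x, forall y, forall z,
         before L x y ==> before L y z ==> before L x z]
    & [forall x, forall y, (x != y) ==> before L x y || before L y x]].

(* [behead (belast x t)] lists the internal vertices of the path x :: t. *)
Definition wacc (T : finType) (G : sgraph T) (L : {set T * T}) (k : nat)
    (y x : T) : bool :=
  before L x y &&
  [exists j : 'I_k.+1, exists t : j.-tuple T,
     is_path G x y t && all (before L x) (behead (belast x t))].

Definition waccs (T : finType) (G : sgraph T) (L : {set T * T}) (k : nat)
    (y : T) : {set T} := [set x | wacc G L k y x].

(* The default value #|T| of the minimum is never smaller than the values
   minimised, and linear orderings exist (see wcol_min and wcol_attained). *)
Definition wcol (T : finType) (G : sgraph T) (k : nat) : nat :=
  1 + \big[minn/#|T|]_(L : {set T * T} | linear_ordering L)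
        \max_(y : T) #|waccs G L k y|.

Lemma linear_ordering_ex (T : finType) :
  exists L : {set T * T}, linear_ordering L.
Proof.
pose L := [set u : T * T | enum_rank u.1 < enum_rank u.2].
exists L; apply/and3P; split.
- by apply/forallP=> x; rewrite /before inE ltnn.
- apply/forallP=> x; apply/forallP=> y; apply/forallP=> z.
  by apply/implyP; rewrite /before !inE /= => xy; apply/implyP; apply: ltn_trans.
- apply/forallP=> x; apply/forallP=> y; apply/implyP.
  by rewrite /before !inE /= -neq_ltn -(inj_eq enum_rank_inj).
Qed.

Lemma wcol_min (T : finType) (G : sgraph T) (k : nat) (L : {set T * T}) :
  linear_ordering L -> wcol G k <= 1 + \max_(y : T) #|waccs G L k y|.
Proof.
move=> linL; rewrite leq_add2l.
elim: (index_enum _) (mem_index_enum L) => // L' s IHs.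
rewrite inE big_cons => /predU1P[<-|/IHs le_s]; first by rewrite linL geq_minl.
by case: ifP => // _; rewrite geq_min le_s orbT.
Qed.

Lemma wcol_attained (T : finType) (G : sgraph T) (k : nat) :
  exists2 L : {set T * T}, linear_ordering L &
    wcol G k = 1 + \max_(y : T) #|waccs G L k y|.
Proof.
have [L0 lin0] := linear_ordering_ex T; rewrite /wcol.
have [Lm linm minm] :=
  arg_minnP (fun L : {set T * T} => \max_(y : T) #|waccs G L k y|) lin0.
exists Lm => //; congr addn; apply/eqP; rewrite eqn_leq.
apply/andP; split; first by have := wcol_min G k linm; rewrite leq_add2l.
apply: (big_ind (fun n => \max_(y : T) #|waccs G Lm k y| <= n)) => //.
- by apply/bigmax_leqP=> y _; apply: max_card.
- by move=> m n Hm Hn; rewrite leq_min Hm.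
Qed.

(* Main.v *)
Require Import Defs.
From mathcomp Require Import all_boot zify.

Set Implicit Arguments.
Unset Strict Implicit.
Unset Printing Implicit Defensive.

(** Fix an ordering [L] attaining [wcol_p(G)] and colour the vertices greedily
    with [q] colours [a] so that [a] separates each vertex from the vertices
    weakly [p]-accessible from it. Give [v] the vector whose [i]-th entry is the
    least length [k <= p/2] of a walk from [v] to a vertex of colour [i] that is
    [L]-minimal on that walk (one extra value if there is none). Let [m] be the
    minimum of a walk of odd length [s <= p] from [x] to [y], cutting it into
    lengths [k1] and [k2]; the shorter one is at most [p/2]. If [x] and [y] had
    the same vector, the entry [k] at [a m] would come from walks from [x] and
    from [y] to vertices of colour [a m]. Joined to the pieces of the given walk
    these have length at most [p], so that both vertices are [m] itself. As
    [2k < s], this contradicts [dist x y = s]; and one of the closed walks of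
    lengths [k + k1], [k + k2] is odd, which contradicts the odd girth
    hypothesis. *)

(** * Greedy colouring and rank functions *)

Lemma chi_le_card (T C : finType) (G : sgraph T) (c : T -> C) :
  (forall x y, G x y -> c x != c y) -> chi G <= #|C|.
Proof.
move=> cP; rewrite /chi; case: ex_minnP => n _; apply.
apply/existsP; exists [ffun x => enum_rank (c x)].
apply/forallP=> x; apply/forallP=> y; apply/implyP=> Gxy.
by rewrite !ffunE (inj_eq enum_rank_inj) cP.
Qed.

(** Colour in order of increasing rank: when [y] gets its colour, the at most [n] vertices of [N y]
    already have theirs, so one of the [n.+1] colours is free. *)
Lemma greedy_coloring (T : finType) (r : T -> nat) (N : T -> {set T}) (n : nat) :
  (forall x y, x \in N y -> r x < r y) -> (forall y, #|N y| <= n) ->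
  exists a : T -> 'I_n.+1, forall x y, x \in N y -> a x != a y.
Proof.
move=> Nr Nn.
suff H b : exists a : T -> 'I_n.+1,
    forall x y, r y < b -> x \in N y -> a x != a y.
  have [a aP] := H (\max_y r y).+1.
  by exists a => x y; apply: aP; rewrite ltnS leq_bigmax.
elim: b => [|b [a aP]]; first by exists (fun=> ord0).
have free y : exists i : 'I_n.+1, i \notin a @: N y.
  apply/existsP; rewrite -negb_forall; apply/negP=> /forallP full.
  have : #|'I_n.+1| <= #|a @: N y| by apply/subset_leq_card/subsetP.
  rewrite card_ord leqNgt ltnS => /negP[].
  exact: leq_trans (leq_imset_card _ _) (Nn y).
exists (fun y => if r y == b then xchoose (free y) else a y) => x y.
rewrite ltnS leq_eqVlt => rb xy; have := Nr _ _ xy => rxy.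
case: eqP rb => [E _|_ /= rb]; last first.
  by rewrite ltn_eqF ?(ltn_trans rxy) //; apply: aP.
rewrite ltn_eqF -?E //.
by apply: contraNneq (xchooseP (free y)) => <-; rewrite imset_f.
Qed.

(** The rank of a vertex is the number of its predecessors, which grows strictly along the
    ordering. *)
Lemma linear_ordering_rank (T : finType) (L : {set T * T}) :
  linear_ordering L ->
  exists2 r : T -> nat, injective r & forall x y, before L x y = (r x < r y).
Proof.
case/and3P=> /forallP irr /forallP tr /forallP tot.
have trL x y z : before L x y -> before L y z -> before L x z.
  by move=> xy yz; have /forallP/(_ y)/forallP/(_ z) := tr x; rewrite xy yz.
pose r y := #|[set x | before L x y]|.
have mono x y : before L x y -> r x < r y.
  move=> xy; apply/proper_card/properP; split.
    by apply/subsetP=> z; rewrite !inE => zx; apply: trL xy.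
  by exists x; rewrite inE // irr.
have total x y : x != y -> before L x y || before L y x.
  by move=> xy; have /forallP/(_ y) := tot x; rewrite xy.
exists r => [x y E|x y].
  by apply/eqP; apply: contraT => /total/orP[] /mono; rewrite E ltnn.
apply/idP/idP => [/mono//|rxy].
have /total/orP[//|/mono] : x != y by apply: contraTneq rxy => ->; rewrite ltnn.
by rewrite ltnNge (ltnW rxy).
Qed.

(** * Walks and odd closed walks *)

Section Walks.
Variables (T : finType) (G : sgraph T).
Implicit Types (P : pred T) (x y z : T) (t : seq T).

(** Vertices may repeat, so that walks can be joined freely; [P] constrains the endpoints too. *)
Definition walk P x y t := [&& path G x t, last x t == y & all P (x :: t)].

Lemma sub_walk P Q x y t : {subset P <= Q} -> walk P x y t -> walk Q x y t.
Proof. by move=> PQ /and3P[pt lt /(sub_all PQ) at_]; apply/and3P. Qed.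

Lemma walk_cat P x y z t u : walk P x y t -> walk P y z u -> walk P x z (t ++ u).
Proof.
case/and3P=> pt /eqP lt at_ /and3P[pu lu /= /andP[_ au]].
by rewrite /walk cat_path last_cat lt pt pu lu -cat_cons all_cat at_ au.
Qed.

Lemma walk_rev P x y t : walk P x y t -> walk P y x (rev (belast x t)).
Proof.
case/and3P=> pt /eqP <- at_.
have E : last x t :: rev (belast x t) = rev (x :: t).
  by rewrite [x :: t]lastI rev_rcons.
apply/and3P; split.
- by rewrite rev_path (eq_path (e' := G)) // => a b; rewrite adj_sym.
- by case: t {pt at_ E} => //= a t; rewrite rev_cons last_rcons.
- by rewrite E all_rev.
Qed.

Lemma walk_shorten P x y t : walk P x y t ->
  exists u, [/\ is_path G x y u, size u <= size t & all P (x :: u)].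
Proof.
case/and3P=> pt /eqP lt at_; case/shortenP: pt lt => u pu Uu sub_u lu.
exists u; split; first by rewrite /is_path pu Uu lu eqxx.
  by apply: uniq_leq_size sub_u; case/andP: Uu.
move: at_ => /= /andP[-> /allP at_] /=.
by apply/allP=> z /sub_u; apply: at_.
Qed.

Lemma has_path_walk k x y : has_path G k x y ->
  exists2 t, walk predT x y t & size t = k.
Proof.
case/existsP=> t /and3P[pt _ lt]; exists t; last exact: size_tuple.
by rewrite /walk pt lt all_predT.
Qed.

Lemma walk_has_path P x y t : walk P x y t ->
  exists2 k, k <= size t & has_path G k x y.
Proof.
case/walk_shorten=> u [pu su _]; exists (size u) => //.
by apply/existsP; exists (in_tuple u).
Qed.

(** A repeated vertex splits a closed walk into two shorter closed walks, one of them odd; without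
    repetition the closed walk is itself a cycle. *)
Lemma odd_cycle_of_closed (c : seq T) : cycle G c -> odd (size c) ->
  exists2 k, k <= size c & odd k && has_cycle G k.
Proof.
have [n] := ubnP (size c); elim: n c => // n IH c; rewrite ltnS => szc cc oc.
have x0 : T by case: c oc {szc cc}.
have [Uc|/(uniqPn x0) [i [j [ij jc E]]]] := boolP (uniq c).
  exists (size c) => //; rewrite oc /has_cycle andTb.
  apply/andP; split; last by apply/existsP; exists (in_tuple c); rewrite /= cc Uc.
  (* Length 1 would be a loop, and lengths 0 and 2 are even. *)
  by case: c cc oc {szc Uc} => [|x [|y [|z c]]] //=; rewrite adj_irr.
(* Rotate the repeated vertex [x] to the front; its second occurrence, at index [j], then cuts the
   rest [w] into [w1] and [w2]. *)
have := cc; rewrite -(rot_cycle i) /rot (drop_nth x0) ?(ltn_trans ij) // cat_cons.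
set x := nth x0 c i; set w := (drop i.+1 c ++ take i c) => cw.
have sw : size c = (size w).+1.
  by rewrite -(size_rot i c) /rot (drop_nth x0) ?(ltn_trans ij).
have xw : x \in w.
  rewrite mem_cat; apply/orP; left; rewrite /x E.
  have -> : j = i.+1 + (j - i.+1) by rewrite subnKC.
  by rewrite -nth_drop mem_nth // size_drop ltn_sub2r // (leq_ltn_trans ij).
move: w xw cw sw => w /splitPr[w1 w2]; rewrite /= rcons_cat cat_path /=.
rewrite size_cat /= => /and3P[p1 lx p2] sw.
have c1 : cycle G (x :: w1) by rewrite /= rcons_path p1.
have c2 : cycle G (x :: w2) by [].
rewrite sw in oc szc.
have [o1|o1] := boolP (odd (size (x :: w1))).
  by have [|k /= kle kP] := IH _ _ c1 o1; [move=> /=|exists k => //]; lia.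
have o2 : odd (size (x :: w2)) by move: o1 oc => /=; lia.
by have [|k /= kle kP] := IH _ _ c2 o2; [move=> /=|exists k => //]; lia.
Qed.

Lemma walk_odd_cycle P x t : walk P x x t -> odd (size t) ->
  exists2 k, k <= size t & odd k && has_cycle G k.
Proof.
case/and3P=> pt /eqP lt _ ot.
have : cycle G (belast x t).
  by case: t pt lt {ot} => //= y t pt lt; rewrite -{2}lt -lastI.
by move/odd_cycle_of_closed; rewrite size_belast; apply.
Qed.

Lemma no_short_odd_cycle n k : at_least (odd_girth G) n -> odd k ->
  has_cycle G k -> n <= k.
Proof.
case E: (odd_girth G) => [g|] /= gn ok ck.
  by have [_ gmin] := (odd_girth_SomeP G g).1 E;
    apply: leq_trans gn (gmin _ _); rewrite ok.
have sz : k < #|T|.+1.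
  case/andP: ck => _ /existsP[c /andP[_ /card_uniqP U]].
  by rewrite ltnS -(size_tuple c) -U max_card.
move: E; rewrite /odd_girth /least.
have : k \in [seq i <- iota 0 #|T|.+1 | odd i && has_cycle G i].
  by rewrite mem_filter ok ck mem_iota.
by case: [seq i <- _ | _].
Qed.

(** * Walks that end at their minimum *)

Section Ranked.
Variables (r : T -> nat) (r_inj : injective r) (L : {set T * T}).
Hypothesis rP : forall x y, before L x y = (r x < r y).

(** A form of weak accessibility of [m] from [v] that uses walks of length exactly [k] and allows
    [m = v]. *)
Definition reach k v m : bool :=
  [exists t : k.-tuple T, walk (fun z => r m <= r z) v m t].

Lemma reachP k v m :
  reflect (exists2 t, walk (fun z => r m <= r z) v m t & size t = k) (reach k v m).
Proof.
apply: (iffP existsP) => [[t wt]|[t wt /eqP st]]; last by exists (Tuple st).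
by exists t; rewrite ?size_tuple.
Qed.

(** Shortening the walk to a path leaves [x] only at its start; as [r] is injective, all other
    vertices then have strictly larger rank. *)
Lemma wacc_of_walk k y x t : x != y -> walk (fun z => r x <= r z) x y t ->
  size t <= k -> wacc G L k y x.
Proof.
move=> xy /walk_shorten[u [pu su au]] st.
have rxz z : r x <= r z -> z != x -> before L x z.
  by move=> le zx; rewrite rP ltn_neqAle le (inj_eq r_inj) eq_sym zx.
have le_uk : size u < k.+1 by rewrite ltnS (leq_trans su).
have yu : y \in x :: u by case/and3P: pu => _ _ /eqP <-; apply: mem_last.
have inner : all (before L x) (behead (belast x u)).
  case: u pu au {su le_uk yu} => // w u /and3P[_ /andP[xu _] _] au.
  apply/allP=> z /= /mem_belast zu; apply: rxz.
    by apply: (allP au); rewrite inE zu orbT.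
  by apply: contraNneq xu => <-.
apply/andP; split; first by rewrite rxz // 1?eq_sym //; apply: (allP au).
apply/existsP; exists (Ordinal le_uk); apply/existsP; exists (in_tuple u).
exact/andP.
Qed.

(** Joined at [v], the two walks form one walk between [m1] and [m2] whose minimum is the smaller of
    these two. *)
Lemma reach_wacc p k1 k2 v m1 m2 : reach k1 v m1 -> reach k2 v m2 ->
  k1 + k2 <= p -> m1 != m2 -> wacc G L p m1 m2 || wacc G L p m2 m1.
Proof.
wlog le : k1 k2 m1 m2 / r m1 <= r m2.
  move=> W r1 r2 kp ne; have /orP[le|le] := leq_total (r m1) (r m2).
    exact: (W k1 k2).
  by rewrite orbC; apply: (W k2 k1) => //; rewrite 1?addnC // eq_sym.
case/reachP=> t1 w1 <- /reachP[t2 w2 <-] kp ne; apply/orP; right.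
apply: (wacc_of_walk (t := rev (belast v t1) ++ t2)) => //; last first.
  by rewrite size_cat size_rev size_belast.
apply: walk_cat (walk_rev w1) _; apply: sub_walk w2 => z.
exact: leq_trans.
Qed.

Lemma walk_split x y t : walk predT x y t ->
  exists m k1 k2, [/\ k1 + k2 = size t, reach k1 x m & reach k2 y m].
Proof.
case/and3P=> pt lt _.
have [m mt minm] := arg_minnP (P := [in x :: t]) r (mem_head x t).
case/splitPl: mt pt lt minm => t1 t2 l1.
rewrite cat_path last_cat l1 => /andP[p1 p2] l2 minm.
have {}minm z : z \in (x :: t1) ++ t2 -> r m <= r z by apply: minm.
exists m, (size t1), (size t2); split; first by rewrite size_cat.
  apply/reachP; exists t1 => //; rewrite /walk p1 l1 eqxx.
  by apply/allP=> z zt; apply: minm; rewrite mem_cat zt.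
apply/reachP; exists (rev (belast m t2)); last by rewrite size_rev size_belast.
apply: walk_rev; rewrite /walk p2 l2; apply/allP=> z; rewrite inE.
case/predU1P=> [->//|zt]; apply: minm.
by rewrite mem_cat zt orbT.
Qed.

(** * The vectors of distances to colours *)

Section Colouring.
Variables (C : finType) (a : T -> C) (p : nat).
Hypothesis odd_p : odd p.
Hypothesis aP : forall x y, wacc G L p y x -> a x != a y.

Lemma reach_color_inj k1 k2 v m1 m2 : reach k1 v m1 -> reach k2 v m2 ->
  k1 + k2 <= p -> a m1 = a m2 -> m1 = m2.
Proof.
move=> r1 r2 kp E; apply/eqP; apply: contraT => ne.
by have /orP[] := reach_wacc r1 r2 kp ne => /aP; rewrite E eqxx.
Qed.

Definition near v i k := [exists m, (a m == i) && reach k v m].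

(* The value [p./2 + 1] means that no vertex of colour [i] is near [v]. *)
Definition color_vector v : {ffun C -> 'I_(p./2).+2} :=
  [ffun i => inord (find (near v i) (iota 0 (p./2).+1))].

Lemma color_vectorE v i :
  color_vector v i = find (near v i) (iota 0 (p./2).+1) :> nat.
Proof.
rewrite ffunE inordK // ltnS -[X in _ <= X](size_iota 0).
exact: find_size.
Qed.

Lemma color_vector_near v i :
  color_vector v i <= p./2 -> near v i (color_vector v i).
Proof.
rewrite color_vectorE -ltnS => lt.
have := lt; rewrite -[X in _ < X](size_iota 0) -has_find => /(nth_find 0).
by rewrite nth_iota.
Qed.

Lemma color_vector_le k v m : reach k v m -> k <= p./2 ->
  color_vector v (a m) <= k.
Proof.
move=> rk kp; rewrite color_vectorE leqNgt; apply/negP=> /(before_find 0).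
by rewrite nth_iota // add0n /near => /existsP[]; exists m; rewrite eqxx.
Qed.

Lemma color_vector_eq x y t : walk predT x y t -> odd (size t) -> size t <= p ->
  color_vector x = color_vector y ->
  exists m k k1 k2, [/\ k1 + k2 = size t, k <= k1 & k <= k2] /\
    [/\ reach k x m, reach k y m, reach k1 x m & reach k2 y m].
Proof.
move=> wt ot tp E; have [m [k1 [k2 [sk r1 r2]]]] := walk_split wt.
(* Reversing the walk exchanges [x] with [y] and [k1] with [k2]. *)
wlog le : x y t wt ot tp E k1 k2 sk r1 r2 / k1 <= k2.
  move=> W; have /orP[|le] := leq_total k1 k2; first exact: (W x y t).
  have su : size (rev (belast x t)) = size t by rewrite size_rev size_belast.
  have sum : k2 + k1 = size (rev (belast x t)) by rewrite addnC su.
  rewrite -su in ot tp; have [m' [k [k2' [k1' [[sk' l2 l1] [q1 q2 q3 q4]]]]]] :=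
    W _ _ _ (walk_rev wt) ot tp (esym E) k2 k1 sum r2 r1 le.
  by exists m', k, k1', k2'; rewrite addnC -su.
have k1p : k1 <= p./2 by lia.
have kle := color_vector_le r1 k1p.
have nx := color_vector_near (leq_trans kle k1p).
have ny : near y (a m) (color_vector x (a m)).
  by rewrite E; apply: color_vector_near; rewrite -E (leq_trans kle).
have [/existsP[m' /andP[/eqP am' q1]] /existsP[m'' /andP[/eqP am'' q2]]] := (nx, ny).
(* With [k] the common entry, [k <= k1 <= k2] and [k1 + k2 <= p], so both [k + k1] and [k + k2] are
   at most [p]. *)
have Em' : m' = m by apply: reach_color_inj q1 r1 _ am'; lia.
have Em'' : m'' = m by apply: reach_color_inj q2 r2 _ am''; lia.
subst m' m''; exists m, (color_vector x (a m)), k1, k2.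
by split; split=> //; lia.
Qed.

End Colouring.
End Ranked.

(** * Assembling the two bounds *)

Lemma exists_color_vector p : odd p ->
  exists c : T -> {ffun 'I_(wcol G p) -> 'I_(p./2).+2},
    forall x y t, walk predT x y t -> odd (size t) -> size t <= p -> c x = c y ->
    exists m k k1 k2,
      [/\ k1 + k2 = size t, k <= k1 & k <= k2] /\
      [/\ exists2 u, walk predT x m u & size u = k,
          exists2 u, walk predT y m u & size u = k,
          exists2 u, walk predT x m u & size u = k1
        & exists2 u, walk predT y m u & size u = k2].
Proof.
move=> odd_p; have [L linL ->] := wcol_attained G p.
have [r r_inj rP] := linear_ordering_rank linL.
(* The summand 1 in [wcol] is the extra colour of the greedy bound. *)
have [x y|y|a aP] := @greedy_coloring T r (waccs G L p) (\max_y #|waccs G L p y|).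
- by rewrite inE => /andP[xy _]; rewrite -rP.
- exact: leq_bigmax.
have waP x y : wacc G L p y x -> a x != a y by move=> w; apply: aP; rewrite inE.
exists (color_vector r a p) => x y t wt ot tp E.
have [m [k [k1 [k2 [sk [q1 q2 q3 q4]]]]]] :=
  color_vector_eq r_inj rP odd_p waP wt ot tp E.
exists m, k, k1, k2; split=> //.
have forget j v : reach r j v m -> exists2 u, walk predT v m u & size u = j.
  by case/reachP=> u wu su; exists u => //; apply: sub_walk wu.
by split; apply: forget.
Qed.

End Walks.

Theorem mainTheorem5 (p : nat) (T : finType) (G : sgraph T) (hp : odd p) :
  let q := wcol G p in
  (chi (odd_union (exact_dist_graph G) p) <= (p./2 + 2) ^ q) /\
  (at_least (odd_girth G) p.+1 ->
   chi (odd_union (exact_power_graph G) p) <= (p./2 + 2) ^ q).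
Proof.
move=> q; have [c cP] := exists_color_vector G hp.
have -> : (p./2 + 2) ^ q = #|{ffun 'I_q -> 'I_(p./2).+2}|.
  by rewrite card_ffun !card_ord addn2.
split=> [|girth]; apply: (chi_le_card (c := c)) => x y;
    move=> /odd_unionP[s [os sp /andP[_ xy]]]; apply/negP=> /eqP E.
  have [/has_path_walk[t wt st] mind] := (dist_SomeP G x y s).1 (eqP xy).
  subst s.
  have [m [k [k1 [k2 [[sk l1 l2] [[u wu su] [v wv sv] _ _]]]]]] :=
    cP _ _ _ wt os sp E.
  (* A path from [x] to [y] through [m] of length at most [2k <= k1 + k2 = s]; as [s] is odd, it is
     shorter than [s]. *)
  have [j jle /mind] := walk_has_path (walk_cat wu (walk_rev wv)).
  move: jle; rewrite size_cat size_rev size_belast su sv; lia.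
have [t wt st] := has_path_walk xy; subst s.
have [m [k [k1 [k2 [[sk l1 l2] [ux uy ux1 uy2]]]]]] := cP _ _ _ wt os sp E.
have even z j : (exists2 u, walk G predT z m u & size u = k) ->
    (exists2 u, walk G predT z m u & size u = j) -> k + j <= p -> ~~ odd (k + j).
  case=> u wu su [v wv sv] kj; apply/negP=> okj.
  have [|i ile /andP[oi ci]] := walk_odd_cycle (walk_cat wu (walk_rev wv)).
    by rewrite size_cat size_rev size_belast su sv.
  have := no_short_odd_cycle girth oi ci.
  move: ile; rewrite size_cat size_rev size_belast su sv; lia.
(* The sum of [k + k1] and [k + k2] is [2k + s], which is odd, so they cannot both be even. *)
have := even _ _ ux ux1; have := even _ _ uy uy2; lia.
Qed.
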